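(* Let $\{(N_k,B_k)\}_{k=1}^\infty$ be a sequence such that, for every $k\ge1$, $B_k$ is a complete residue system modulo $M_k$ and $N_k\ge M_k\ge 2$ are integers. Let $\mu$ be the infinite convolution of $\{(N_k,B_k)\}_{k=1}^\infty$ and let $\nu_{>k}$ be the associated tail measures. Suppose that $B_k$ satisfies the uniform discrete zero condition for every $k\ge 1$, and that $\{\nu_{>k}\}_{k=1}^\infty$ is tight. If $\mu$ is a spectral measure, then $M_k\mid N_k$ for all $k\ge2$.
   Context: A finite set $B\subset\mathbb{Z}$ is a complete residue system modulo $M\in\mathbb{N}$ if $B\equiv\{0,1,\dots,M-1\}\pmod M$, i.e. $\#B=M$ and each residue class modulo $M$ is represented by exactly one element of $B$. For such $B$ put $b_*=\min B$ and let the character polynomial be $f_B(x)=\dfrac{\sum_{b\in B}x^b}{x^{b_*}\sum_{k=0}^{\#B-1}x^k}$ (this quotient is a polynomial, and is regarded as one when evaluated). For a function $f$ on $\mathbb{R}$ put $\mathcal{Z}(f)=\{x\in\mathbb{R}:f(x)=0\}$. The complete residue system $B$ modulo $M$ satisfies the uniform discrete zero condition if $\mathcal{Z}(x\mapsto f_B(e^{-2\pi i x}))\subseteq\{j/M: j\in\mathbb{Z}\setminus M\mathbb{Z}\}$. For a finite nonempty set $A\subset\mathbb{R}$, $\delta_A=\frac1{\#A}\sum_{a\in A}\delta_a$ with $\delta_a$ the Dirac measure at $a$. The infinite convolution $\mu=\delta_{N_1^{-1}B_1}*\delta_{(N_1N_2)^{-1}B_2}*\cdots$ is the weak limit, as $n\to\infty$,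 of $\mu_n=\delta_{N_1^{-1}B_1}*\cdots*\delta_{(N_1\cdots N_n)^{-1}B_n}$, assumed to exist as a Borel probability measure. The tail measure is $\nu_{>k}=\delta_{N_{k+1}^{-1}B_{k+1}}*\delta_{(N_{k+1}N_{k+2})^{-1}B_{k+2}}*\cdots$ (also a weak limit of finite convolutions). A family $\Phi$ of Borel probability measures on $\mathbb{R}$ is tight if for each $\epsilon>0$ there is a compact $K\subset\mathbb{R}$ with $\inf_{\eta\in\Phi}\eta(K)>1-\epsilon$. A Borel probability measure $\mu$ on $\mathbb{R}$ is a spectral measure if there is a countable $\Lambda\subseteq\mathbb{R}$ such that $\{e^{-2\pi i\lambda x}:\lambda\in\Lambda\}$ is an orthonormal basis of $L^2(\mu)$. *)

(* Defs.v *)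
From HB Require Import structures.
From mathcomp Require Import all_boot all_order all_algebra.
From mathcomp Require Import finmap.
From mathcomp Require Import all_classical all_reals all_analysis.
From mathcomp Require Import complex.

Set Implicit Arguments.
Unset Strict Implicit.
Unset Printing Implicit Defensive.

Import Order.TTheory GRing.Theory Num.Theory.
Import numFieldNormedType.Exports.

Local Open Scope classical_set_scope.
Local Open Scope ring_scope.

Definition complete_residue_system (M : nat) (B : {fset int}) : Prop :=
  #|` B|%fset = M /\
  forall r : int, exists! b : int, b \in B /\ (b = r %[mod M%:Z])%Z.

Definition fset_min (B : {fset int}) : int :=
  \big[Order.min/head 0 B]_(b <- B) b.

Section characters.
Context {R : realType}.

Definition cis (t : R) : R[i] := Complex (cos t) (sin t).

(* The exponents b - min B are nonnegative, so both terms of the quotient are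
   ordinary polynomials; the division is exact when B is a complete residue
   system modulo #|B|. *)
Definition character_polynomial (B : {fset int}) : {poly R[i]} :=
  (\sum_(b <- B) 'X^(absz (b - fset_min B))) %/ (\sum_(k < #|` B|%fset) 'X^k).

Definition zero_set (f : R -> R[i]) : set R := [set x | f x = 0].

Definition uniform_discrete_zero (M : nat) (B : {fset int}) : Prop :=
  zero_set (fun x => (character_polynomial B).[cis (- (2 * pi * x))]) `<=`
  [set j%:~R / M%:R | j in [set j : int | ~~ (M%:Z %| j)%Z]].

End characters.

Arguments uniform_discrete_zero R M B : clear implicits.

Section convolution.
Context {R : realType}.
Local Open Scope ereal_scope.

Definition convolution (mu nu : {finite_measure set R -> \bar R}) :=
  pushforward (mu \x nu) (fun p : R * R => (p.1 + p.2)%R).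

Variables mu nu : {finite_measure set R -> \bar R}.

Let measurable_add : measurable_fun [set: R * R] (fun p : R * R => (p.1 + p.2)%R).
Proof. exact: (@measurable_realfun.measurable_funD _ _ R). Qed.

Let convolution0 : convolution mu nu set0 = 0.
Proof. by rewrite /convolution /pushforward preimage_set0 measure0. Qed.

Let convolution_ge0 A : 0 <= convolution mu nu A.
Proof. exact: measure_ge0. Qed.

Let convolution_sigma_additive : semi_sigma_additive (convolution mu nu).
Proof.
move=> F mF tF mUF; rewrite /convolution /pushforward preimage_bigcup.
apply: measure_semi_sigma_additive.
- by move=> n; rewrite -[X in measurable X]setTI; exact: measurable_add.
- apply/trivIsetP => /= i j _ _ ij; rewrite -preimage_setI.
  by move/trivIsetP : tF => /(_ _ _ _ _ ij) ->//; rewrite preimage_set0.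
- by rewrite -preimage_bigcup -[X in measurable X]setTI; exact: measurable_add.
Qed.

HB.instance Definition _ := isMeasure.Build _ _ _ (convolution mu nu)
  convolution0 convolution_ge0 convolution_sigma_additive.

Let convolution_finite : fin_num_fun (convolution mu nu).
Proof.
apply: lty_fin_num_fun.
rewrite [X in X < _](_ : _ = (mu \x nu) (setT `*` setT)); last by rewrite setXTT.
rewrite product_measure1E//.
by rewrite lte_mul_pinfty// ?fin_num_measure// -ge0_fin_numE// fin_num_measure.
Qed.

HB.instance Definition _ :=
  Measure_isFinite.Build _ _ _ (convolution mu nu) convolution_finite.

End convolution.

Section uniform_measure.
Context {R : realType}.
Local Open Scope ereal_scope.

Definition uniform_measure (A : {fset R}) :=
  mscale ((#|` A|%fset%:R^-1 : R)%:nng)%R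
    (msum (fun i => \d_(nth 0%R A i)) #|` A|%fset).

Variable A : {fset R}.

HB.instance Definition _ := Measure.on (uniform_measure A).

Let uniform_measure_finite : fin_num_fun (uniform_measure A).
Proof.
apply: lty_fin_num_fun; rewrite /uniform_measure /mscale/= /msum.
rewrite lte_mul_pinfty//.
by apply: lte_sum_pinfty => i _; rewrite /dirac ltry.
Qed.

HB.instance Definition _ :=
  Measure_isFinite.Build _ _ _ (uniform_measure A) uniform_measure_finite.

End uniform_measure.

Section infinite_convolution.
Context {R : realType}.

Definition scaled_digits (N : nat -> nat) (B : nat -> {fset int})
    (k j : nat) : {fset R} :=
  [fset b%:~R / (\prod_(k.+1 <= i < j.+1) N i)%:R | b in B j]%fset.

(* The first n factors of the convolution of the (N_j, B_j) with j > k; the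
   unit mass at 0 is neutral for the convolution. *)
Fixpoint partial_convolution (N : nat -> nat) (B : nat -> {fset int})
    (k n : nat) : {finite_measure set R -> \bar R} :=
  if n is n'.+1 then
    convolution (partial_convolution N B k n')
                (uniform_measure (scaled_digits N B k (k + n)))
  else \d_(0 : R).

Definition weak_cvg (mu_ : nat -> {measure set R -> \bar R})
    (mu : {measure set R -> \bar R}) : Prop :=
  forall f : R -> R, continuous f -> bounded_fun f ->
    (\int[mu_ n]_x f x) @[n --> \oo] --> \int[mu]_x f x.

Definition tight (Phi : set (probability R R)) : Prop :=
  forall eps : R, 0 < eps -> exists K : set R, compact K /\
    ((1 - eps)%:E < ereal_inf [set (eta : probability R R) K | eta in Phi])%E.

(* nu is the convolution of the (N_j, B_j) with j > k. *)
Definition is_tail_convolution (N : nat -> nat) (B : nat -> {fset int})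
    (k : nat) (nu : probability R R) : Prop :=
  weak_cvg (partial_convolution N B k) nu.

Definition is_infinite_convolution (N : nat -> nat) (B : nat -> {fset int})
    (mu : probability R R) : Prop :=
  is_tail_convolution N B 0 mu.

End infinite_convolution.

Section spectral_measure.
Context {R : realType}.
Variable mu : probability R R.

Definition L2_complex (f : R -> R[i]) : Prop :=
  (fun x => complex.Re (f x)) \in Lfun mu 2%:E /\
  (fun x => complex.Im (f x)) \in Lfun mu 2%:E.

Definition integral_complex (f : R -> R[i]) : R[i] :=
  Complex (\int[mu]_x complex.Re (f x)) (\int[mu]_x complex.Im (f x)).

Definition inner_product (f g : R -> R[i]) : R[i] :=
  integral_complex (fun x => f x * (g x)^*%C).

Definition L2_norm (f : R -> R[i]) : R :=
  Num.sqrt (complex.Re (inner_product f f)).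

Definition orthonormal_on (I : set R) (e : R -> R -> R[i]) : Prop :=
  (forall i, I i -> L2_complex (e i)) /\
  forall i j, I i -> I j -> inner_product (e i) (e j) = (i == j)%:R.

(* The linear span of the e i, i in I, is dense in L2. *)
Definition complete_on (I : set R) (e : R -> R -> R[i]) : Prop :=
  forall f, L2_complex f -> forall eps : R, 0 < eps ->
    exists (F : {fset R}) (c : R -> R[i]), [set` F] `<=` I /\
      L2_norm (fun x => f x - \sum_(i <- F) c i * e i x) < eps.

Definition orthonormal_basis_on (I : set R) (e : R -> R -> R[i]) : Prop :=
  orthonormal_on I e /\ complete_on I e.

Definition is_spectral_measure : Prop :=
  exists Lambda : set R, countable Lambda /\
    orthonormal_basis_on Lambda (fun l x => cis (- (2 * pi * l * x))).

End spectral_measure.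

(* Main.v *)
Require Import Defs.
From mathcomp Require Import all_boot all_order all_algebra.
From mathcomp Require Import finmap.
From mathcomp Require Import all_classical all_reals all_analysis.
From mathcomp Require Import measurable_realfun complex ring lra zify.

Set Implicit Arguments.
Unset Strict Implicit.
Unset Printing Implicit Defensive.

Import Order.TTheory GRing.Theory Num.Theory.
Import numFieldNormedType.Exports.

Local Open Scope classical_set_scope.
Local Open Scope ring_scope.

(** Write P_k = N_1 ... N_k and phi_k(xi) = hat nu_k(xi / P_k), where
    nu_0 = mu and nu_k is the tail measure for k >= 1.  Passing to the weak
    limit in the finite convolutions gives
      phi_k(xi) = m_(k+1)(xi / P_(k+1)) * phi_(k+1)(xi),
    where m_j, the mask of B_j, is the normalized exponential sum over B_j.
    Two facts about a complete residue system B modulo M are needed: the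
    zeros of its mask lie in (1/M)Z, since each of them comes from a zero of
    1 + x + ... + x^(M-1) or from one of the character polynomial
    ([mask_zero]), and sum_(i < M) |m(t - i/M)|^2 = 1 for every t
    ([sum_mask_translates]).

    A spectrum L of mu is described by phi_0 alone: phi_0 vanishes at the
    differences of distinct points of L, and the sum over l in L of
    |phi_0(s - l)|^2 is 1 ([spectral_parseval]).  Call L a Parseval set of phi
    if it has these two properties, the second one for all s outside a
    countable set.

    The heart of the proof is a descent from phi = m(. / P) psi to psi.  Let
    d = P/M, and cut a Parseval set L of phi into classes modulo dZ, each of
    which is cut into M cells, the classes modulo PZ = M dZ.  A selection
    keeps one cell of each class.  Inside a selection no difference is a zero
    of m(. / P), so a selection is orthogonal for psi and the sum of
    |psi(s - l)|^2 over it is at most 1 by Bessel's inequality.  On the other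
    hand, the Parseval identity of phi says that the masses of the cells,
    averaged in each class with the weights |m((s - l)/P)|^2, which add up to
    1 over the M cells, sum to 1.  Since the selection of the heaviest cells
    has mass at most 1, the mean is everywhere equal to the maximum: the M
    cells of a class have the same mass ([cell_mass_const]).  Hence every
    selection is a Parseval set of psi ([selection_parseval]), and each class
    that L meets has M nonempty cells ([cells_full]).

    Iterating the descent reduces the theorem to two consecutive scales
    ([two_scales_dvdn]): phi = m(. / P) psi and psi = m'(. / P n) chi, where
    M' | n has to be shown.  Put d' = P n/M'.  Take l0 in L and a selection
    that keeps its cell.  Applied to the selection and to psi, fullness gives
    a point l1 of the selection with l1 - l0 in d' + P n Z.  If M' does not
    divide n, then l1 - l0 is not in PZ, so l1 lies in another class modulo
    dZ.  Now change the selection in the class of l0 only, so that it keeps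
    the cell of a point l2 of L in l0 + d + PZ.  Fullness for the new
    selection gives l3 in l2 + d' + P n Z.  Then l3 - l1 is in d + PZ, so l3
    and l1 are in different cells of the same class.  But both selections
    agree on this class, a contradiction since M > 1. *)

(** * Weighted averages and selections *)

Lemma esum_fibers (R : realType) (T A : choiceType) (S : set T) (D : set A)
    (g : T -> A) (f : T -> \bar R) :
  (forall x, S x -> D (g x)) -> (forall x, S x -> 0 <= f x)%E ->
  (\esum_(x in S) f x =
   \esum_(a in D) \esum_(x in S `&` [set x | g x = a]) f x)%E.
Proof.
move=> SD f0; rewrite (esum_esum (a := fun _ x => f x)); last first.
  by move=> a x _ [/f0].
rewrite (@reindex_esum _ _ _ S _ (fun x => (g x, x)))//.
split.
- by move=> x Sx /=; split => //=; exact: SD.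
- by move=> x y _ _ [].
- by move=> [a x] /= [_ [Sx gxa]]; exists x => //; rewrite gxa.
Qed.

(** A strict inequality at one index would persist in the sums, because the
    sum of [f] over the other indices is finite. *)
Lemma esum_squeeze_eq (R : realType) (A : choiceType) (D : set A)
    (f g : A -> \bar R) :
  (forall a, D a -> 0 <= f a)%E -> (forall a, D a -> f a <= g a)%E ->
  (\esum_(a in D) f a = 1)%E -> (\esum_(a in D) g a <= 1)%E ->
  forall a, D a -> f a = g a.
Proof.
move=> f0 fg f1 g1 a Da; apply/eqP; rewrite eq_le fg//= leNgt; apply/negP => ltfg.
have g0 b : D b -> (0 <= g b)%E by move=> Db; exact: le_trans (f0 _ Db) (fg _ Db).
move: f1 g1; rewrite (esumID [set a] D f)// (esumID [set a] D g)//.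
have -> : D `&` [set a] = [set a] by apply/seteqP; split => [x []//|x ->].
rewrite !esum_set1 ?f0 ?g0// => f1.
apply/negP; rewrite -ltNge -f1.
have le12 : (\esum_(i in D `&` ~` [set a]) f i <=
             \esum_(i in D `&` ~` [set a]) g i)%E.
  by apply: le_esum => i [/fg].
apply: (@lt_le_trans _ _ (g a + \esum_(i in D `&` ~` [set a]) f i)%E); last first.
  exact: leeD2l.
rewrite lteD2rE//; move: (congr1 (fun x => x \is a fin_num) f1) => /=.
by rewrite fin_numD => /andP[].
Qed.

Lemma esumZl (R : realType) (T : choiceType) (S : set T) (c : R)
    (f : T -> \bar R) : 0 < c -> (forall x, S x -> 0 <= f x)%E ->
  (\esum_(x in S) (c%:E * f x) = c%:E * \esum_(x in S) f x)%E.
Proof.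
move=> c0 f0; rewrite /esum -ereal_sup_pZl// image_comp.
congr ereal_sup; apply: eq_imagel => X [finX XS] /=.
rewrite !fsbig_finite//= big_seq [in RHS]big_seq ge0_sume_distrr// => x.
by rewrite in_fset_set// inE => /XS /f0.
Qed.

Section selection.
Variables (R : realType) (T A : choiceType) (n : nat).
Variables (L : set T) (g : T -> A) (idx : T -> 'I_n).
Variables (w : A -> 'I_n -> R) (p : T -> R).
Hypothesis w_gt0 : forall x, L x -> forall i, 0 < w (g x) i.
Hypothesis sum_w : forall x, L x -> \sum_i w (g x) i = 1.
Hypothesis p_ge0 : forall x, 0 <= p x.
Hypothesis sum_wp : (\esum_(x in L) (w (g x) (idx x) * p x)%:E = 1)%E.

(** The points of [L] are sorted into classes by [g], and inside a class into
    [n] cells by [idx]; [tau] picks one cell of each class. *)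
Definition selection (tau : A -> 'I_n) : set T :=
  L `&` [set x | idx x = tau (g x)].

Hypothesis sum_selection_le : forall tau : A -> 'I_n,
  (\esum_(x in selection tau) (p x)%:E <= 1)%E.

Definition cell_mass (a : A) (i : 'I_n) : \bar R :=
  (\esum_(x in L `&` [set x | g x = a] `&` [set x | idx x = i]) (p x)%:E)%E.

Lemma cell_mass_ge0 a i : (0 <= cell_mass a i)%E.
Proof. by apply: esum_ge0 => x _; rewrite lee_fin. Qed.

Lemma sum_selectionE tau :
  (\esum_(x in selection tau) (p x)%:E =
   \esum_(a in g @` L) cell_mass a (tau a))%E.
Proof.
rewrite (esum_fibers (D := g @` L) (g := g)).
- apply: eq_esum => a _; congr (esum _ _); apply/seteqP; split => x /=.
    by move=> [[Lx e] ga]; split => //; rewrite -ga.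
  by move=> [[Lx ga] e]; split => //; split => //=; rewrite ga.
- by move=> x [Lx _]; exists x.
- by move=> x _; rewrite lee_fin.
Qed.

Lemma cell_mass_le1 a i : (cell_mass a i <= 1)%E.
Proof.
have [[x Lx gxa]|na] := pselect ((g @` L) a); last first.
  rewrite /cell_mass (_ : _ `&` _ = set0) ?esum_set0//.
  by apply/seteqP; split => // x [[Lx ga] _]; apply: na; exists x.
apply: le_trans (sum_selection_le (fun=> i)).
rewrite sum_selectionE (esumID [set a])//; last first.
  by move=> b _; exact: cell_mass_ge0.
have -> : g @` L `&` [set a] = [set a].
  by apply/seteqP; split => [b []//|b ->]; split => //; exists x.
rewrite esum_set1 ?cell_mass_ge0// leeDl// esum_ge0// => b _.
exact: cell_mass_ge0.
Qed.

Lemma sum_weightedE :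
  (\esum_(x in L) (w (g x) (idx x) * p x)%:E =
   \esum_(a in g @` L) \sum_i (w a i)%:E * cell_mass a i)%E.
Proof.
rewrite (esum_fibers (D := g @` L) (g := g)); first last.
- by move=> x Lx; rewrite lee_fin mulr_ge0// ltW// w_gt0.
- by move=> x Lx; exists x.
apply: eq_esum => _ [x0 Lx0 <-]; set a := g x0.
transitivity (\esum_(x in L `&` [set x | g x = a])
    \sum_i (if idx x == i then (w a i)%:E * (p x)%:E else 0))%E.
  apply: eq_esum => x [Lx gx].
  rewrite (bigD1 (idx x))//= eqxx big1 ?adde0 ?gx ?EFinM// => i.
  by rewrite eq_sym => /negbTE ->.
rewrite esum_sum; last first.
  move=> x i [Lx _] _; case: ifP => // _.
  by rewrite mule_ge0// lee_fin// ltW// w_gt0.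
apply: eq_bigr => i _.
rewrite /cell_mass -esumZl ?w_gt0//; last by move=> x _; rewrite lee_fin.
rewrite [RHS]esum_mkcondr; apply: eq_esum => x _.
rewrite (_ : (x \in _) = (idx x == i))//.
by apply/idP/idP; rewrite inE /= => /eqP.
Qed.

(** The selection of the heaviest cell of each class has mass at most 1, and
    the weighted means of the cell masses already sum to 1; so each mean
    equals the maximum, and positive weights force all the cells of a class
    to be as heavy as the heaviest one. *)
Lemma cell_mass_const x i j : L x -> cell_mass (g x) i = cell_mass (g x) j.
Proof.
move=> Lx0; have i0 : 'I_n := idx x.
pose best a := [arg max_(k > i0) cell_mass a k]%O.
have bestP a k : (cell_mass a k <= cell_mass a (best a))%E.
  by rewrite /best; case: Order.TotalTheory.arg_maxP => // m _; exact.
have mfin a k : cell_mass a k \is a fin_num.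
  by rewrite ge0_fin_numE ?cell_mass_ge0// (le_lt_trans (cell_mass_le1 a k)) ?ltry.
have wavg a : (g @` L) a -> (\sum_k (w a k)%:E * cell_mass a (best a) =
    cell_mass a (best a))%E.
  move=> [y Ly <-]; rewrite -ge0_sume_distrl; last first.
    by move=> k _; rewrite lee_fin ltW// w_gt0.
  by rewrite sumEFin sum_w// mul1e.
have eqs : forall a, (g @` L) a ->
    (\sum_k (w a k)%:E * cell_mass a k = cell_mass a (best a))%E.
  apply: esum_squeeze_eq.
  - move=> a [y Ly <-]; apply: sume_ge0 => k _.
    by rewrite mule_ge0 ?cell_mass_ge0// lee_fin ltW// w_gt0.
  - move=> a La; rewrite -[leRHS]wavg//; apply: lee_sum => k _.
    apply: lee_wpmul2l => //; case: La => y Ly <-.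
    by rewrite lee_fin ltW// w_gt0.
  - by rewrite -sum_weightedE.
  - by rewrite -(sum_selectionE best).
have main k : cell_mass (g x) k = cell_mass (g x) (best (g x)).
  set a := g x.
  have La : (g @` L) a by exists x.
  have := wavg a La; rewrite -[in RHS]eqs//.
  have E k' : cell_mass a k' = (fine (cell_mass a k'))%:E by rewrite fineK.
  rewrite (eq_bigr (fun k => (w a k * fine (cell_mass a (best a)))%:E)); last first.
    by move=> k' _; rewrite EFinM -E.
  rewrite [in RHS](eq_bigr (fun k => (w a k * fine (cell_mass a k))%:E)); last first.
    by move=> k' _; rewrite EFinM -E.
  rewrite !sumEFin => -[] /eqP; rewrite -subr_eq0 -sumrB psumr_eq0; last first.
    move=> k' _; rewrite -mulrBr mulr_ge0 ?(ltW (w_gt0 _ _))// subr_ge0.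
    by rewrite -lee_fin -!E.
  move/allP => /(_ k (mem_index_enum _)) /=.
  rewrite -mulrBr mulf_eq0 gt_eqF ?w_gt0//= subr_eq0 => /eqP h.
  by rewrite E -h -E.
by rewrite (main i) (main j).
Qed.

Lemma sum_selection (tau : A -> 'I_n) :
  (\esum_(x in selection tau) (p x)%:E = 1)%E.
Proof.
rewrite sum_selectionE -sum_wp sum_weightedE; apply: eq_esum => _ [x Lx <-].
rewrite (eq_bigr (fun k => (w (g x) k)%:E * cell_mass (g x) (tau (g x))))%E; last first.
  by move=> k _; congr (_ * _)%E; exact: cell_mass_const.
rewrite -ge0_sume_distrl; last by move=> k _; rewrite lee_fin ltW// w_gt0.
by rewrite sumEFin sum_w// mul1e.
Qed.

End selection.

(** * Integrals of bounded complex functions *)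

Section real_bounded.
Context d (T : measurableType d) (R : realType).
Implicit Types f g : T -> R.

Definition bmeas f := measurable_fun setT f /\ exists K, forall x, `|f x| <= K.

Lemma bmeas_cst (c : R) : bmeas (fun=> c).
Proof. by split; [exact: measurable_cst|exists `|c|]. Qed.

Lemma bmeasD f g : bmeas f -> bmeas g -> bmeas (fun x => f x + g x).
Proof.
move=> [mf [K fK]] [mg [L gL]]; split; first exact: measurable_funD.
by exists (K + L) => x; rewrite (le_trans (ler_normD _ _))// lerD.
Qed.

Lemma bmeasM f g : bmeas f -> bmeas g -> bmeas (fun x => f x * g x).
Proof.
move=> [mf [K fK]] [mg [L gL]]; split; first exact: measurable_funM.
by exists (K * L) => x; rewrite normrM ler_pM.
Qed.

Lemma bmeasN f : bmeas f -> bmeas (fun x => - f x).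
Proof.
move=> [mf [K fK]]; split; first exact: measurableT_comp.
by exists K => x; rewrite normrN.
Qed.

Lemma bmeasB f g : bmeas f -> bmeas g -> bmeas (fun x => f x - g x).
Proof. by move=> bf bg; apply: bmeasD => //; exact: bmeasN. Qed.

Lemma bmeas_integrable_lty (m : {measure set T -> \bar R}) f :
  (m setT < +oo)%E -> bmeas f -> m.-integrable setT (EFin \o f).
Proof.
move=> moo [mf [K fK]]; apply: measurable_bounded_integrable => //.
by exists K; split; [exact: num_real|]; move=> x Kx y _ /=; exact: le_trans (fK y) (ltW Kx).
Qed.

Lemma bmeas_integrable (m : {finite_measure set T -> \bar R}) f :
  bmeas f -> m.-integrable setT (EFin \o f).
Proof.
by apply: bmeas_integrable_lty; rewrite -ge0_fin_numE// fin_num_measure.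
Qed.

End real_bounded.

Lemma bmeas_comp d1 d2 (T1 : measurableType d1) (T2 : measurableType d2)
    (R : realType) (f : T2 -> R) (h : T1 -> T2) :
  measurable_fun setT h -> bmeas f -> bmeas (f \o h).
Proof.
move=> mh [mf [K fK]]; split; first exact: measurableT_comp.
by exists K => x; exact: fK.
Qed.

Lemma product_measure_lty (R : realType) (m1 m2 : {finite_measure set R -> \bar R}) :
  ((m1 \x m2) setT < +oo)%E.
Proof.
rewrite -setXTT product_measure1E//.
by rewrite lte_mul_pinfty// ?fin_num_measure// -ge0_fin_numE// fin_num_measure.
Qed.

Lemma Rintegral_prod (R : realType) (m1 m2 : {finite_measure set R -> \bar R})
    (f g : R -> R) : bmeas f -> bmeas g ->
  \int[(m1 \x m2)%E]_z (f z.1 * g z.2) = \int[m1]_x f x * \int[m2]_y g y.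
Proof.
move=> bf bg.
have bfg : bmeas (fun z : R * R => f z.1 * g z.2).
  by apply: bmeasM; [apply: (bmeas_comp (h := fst))|apply: (bmeas_comp (h := snd))].
have ifg : (m1 \x m2)%E.-integrable setT (EFin \o (fun z : R * R => f z.1 * g z.2)).
  by apply: bmeas_integrable_lty => //; exact: product_measure_lty.
rewrite /Rintegral -(integral12_prod_meas1 ifg) /fubini_F/=.
have ig := bmeas_integrable m2 bg; have if_ := bmeas_integrable m1 bf.
under eq_integral => x _.
  under eq_integral => y _ do rewrite EFinM.
  rewrite integralZl//.
  rewrite -[X in (_ * X)%E]fineK; last exact: integrable_fin_num ig.
  over.
rewrite /= integralZr// -fineM//=.
by rewrite fineK//; exact: integrable_fin_num ig.
exact: integrable_fin_num if_.
exact: integrable_fin_num ig.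
Qed.

Section complex_bounded.
Context d (T : measurableType d) (R : realType).
Implicit Types f g : T -> R[i].

Definition cbmeas f := bmeas (fun x => complex.Re (f x)) /\
                       bmeas (fun x => complex.Im (f x)).

Definition cint (m : {measure set T -> \bar R}) f : R[i] :=
  Complex (\int[m]_x complex.Re (f x)) (\int[m]_x complex.Im (f x)).

Lemma cbmeas_cst (c : R[i]) : cbmeas (fun=> c).
Proof. by split; exact: bmeas_cst. Qed.

Lemma cbmeasD f g : cbmeas f -> cbmeas g -> cbmeas (fun x => f x + g x).
Proof.
move=> [rf jf] [rg jg]; split.
- rewrite (_ : (fun x => _) = (fun x => complex.Re (f x) + complex.Re (g x))).
    exact: bmeasD.
  by apply/funext => x; case: (f x) (g x) => ? ? [].
- rewrite (_ : (fun x => _) = (fun x => complex.Im (f x) + complex.Im (g x))).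
    exact: bmeasD.
  by apply/funext => x; case: (f x) (g x) => ? ? [].
Qed.

Lemma cbmeasM f g : cbmeas f -> cbmeas g -> cbmeas (fun x => f x * g x).
Proof.
move=> [rf jf] [rg jg]; split.
- rewrite (_ : (fun x => _) = (fun x => complex.Re (f x) * complex.Re (g x) -
    complex.Im (f x) * complex.Im (g x))).
    by apply: bmeasB; exact: bmeasM.
  by apply/funext => x; case: (f x) (g x) => ? ? [].
- rewrite (_ : (fun x => _) = (fun x => complex.Re (f x) * complex.Im (g x) +
    complex.Im (f x) * complex.Re (g x))).
    by apply: bmeasD; exact: bmeasM.
  by apply/funext => x; case: (f x) (g x) => ? ? [].
Qed.

Lemma cbmeas_sum (I : Type) (s : seq I) (F : I -> T -> R[i]) :
  (forall i, cbmeas (F i)) -> cbmeas (fun x => \sum_(i <- s) F i x).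
Proof.
move=> bF; elim: s => [|i s ih].
  by under eq_fun do rewrite big_nil; exact: cbmeas_cst.
by under eq_fun do rewrite big_cons; exact: cbmeasD.
Qed.

Variable m : {finite_measure set T -> \bar R}.

Lemma cintD f g : cbmeas f -> cbmeas g ->
  cint m (fun x => f x + g x) = cint m f + cint m g.
Proof.
move=> [rf jf] [rg jg]; rewrite /cint; apply/eqP; rewrite eq_complex /=.
rewrite -!RintegralD//; try exact: bmeas_integrable.
by apply/andP; split; apply/eqP; apply: eq_Rintegral => x _;
  case: (f x) (g x) => ? ? [].
Qed.

Lemma cintZ (c : R[i]) f : cbmeas f -> cint m (fun x => c * f x) = c * cint m f.
Proof.
case: c => a b [rf jf]; rewrite /cint; apply/eqP; rewrite eq_complex /=.
have bZ (e : R) h : bmeas h -> bmeas (fun x : T => e * h x).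
  by move=> bh; apply: bmeasM => //; exact: bmeas_cst.
rewrite -!RintegralZl//; try exact: bmeas_integrable.
rewrite -RintegralB//; try by apply: bmeas_integrable; apply: bZ.
rewrite -RintegralD//; try by apply: bmeas_integrable; apply: bZ.
by apply/andP; split; apply/eqP; apply: eq_Rintegral => x _; case: (f x).
Qed.

Lemma cint_conj f : cbmeas f -> cint m (fun x => (f x)^*%C) = ((cint m f)^*)%C.
Proof.
move=> [rf jf]; rewrite /cint; apply/eqP; rewrite eq_complex /=.
rewrite -[X in _ && (_ == X)]mulN1r -RintegralZl//; last exact: bmeas_integrable.
by apply/andP; split; apply/eqP; apply: eq_Rintegral => x _;
  case: (f x) => //= ? ?; rewrite mulN1r.
Qed.

Lemma cint_cst (c : R[i]) : cint m (fun=> c) = c * (fine (m setT))%:C%C.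
Proof.
case: c => a b; rewrite /cint !Rintegral_cst//; apply/eqP.
by rewrite eq_complex /= !mulr0 subr0 add0r !eqxx.
Qed.

Lemma cint_sum (I : Type) (s : seq I) (F : I -> T -> R[i]) :
  (forall i, cbmeas (F i)) ->
  cint m (fun x => \sum_(i <- s) F i x) = \sum_(i <- s) cint m (F i).
Proof.
move=> bF; elim: s => [|i s ih].
  under eq_fun do rewrite big_nil.
  by rewrite cint_cst mul0r big_nil.
under eq_fun do rewrite big_cons.
by rewrite cintD ?big_cons ?ih//; exact: cbmeas_sum.
Qed.

End complex_bounded.

(** * Characteristic functions, Bessel and Parseval *)

Section squared_modulus.
Variable R : realType.
Implicit Types z w : R[i].

Definition sqnorm z : R := complex.Re z ^+ 2 + complex.Im z ^+ 2.

Lemma mul_conjc z : z * (z^*)%C = (sqnorm z)%:C%C.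
Proof.
by case: z => a b; apply/eqP; rewrite eq_complex /sqnorm /=;
  apply/andP; split; apply/eqP; ring.
Qed.

Lemma sqnorm_ge0 z : 0 <= sqnorm z.
Proof. by rewrite addr_ge0// sqr_ge0. Qed.

Lemma sqnormM z w : sqnorm (z * w) = sqnorm z * sqnorm w.
Proof. by case: z w => a b [e f]; rewrite /sqnorm /=; ring. Qed.

Lemma sqnorm_eq0 z : (sqnorm z == 0) = (z == 0).
Proof.
by case: z => a b; rewrite /sqnorm eq_complex /= paddr_eq0 ?sqr_ge0// !sqrf_eq0.
Qed.

Lemma sqnorm0 : sqnorm 0 = 0.
Proof. by apply/eqP; rewrite sqnorm_eq0. Qed.

End squared_modulus.

Section characteristic_function.
Variable R : realType.

Definition char (t x : R) : R[i] := cis (- (2 * pi * t * x)).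

Global Arguments char : simpl never.

(** The Fourier transform of the measure [m]. *)
Definition char_fun (m : {measure set R -> \bar R}) (t : R) : R[i] := cint m (char t).

Global Arguments char_fun : simpl never.

Lemma cisD (a b : R) : cis (a + b) = cis a * cis b.
Proof.
rewrite /cis cosD sinD; apply/eqP; rewrite eq_complex /=.
by apply/andP; split; apply/eqP; ring.
Qed.

Lemma cisN (a : R) : cis (- a) = ((cis a)^*)%C.
Proof. by rewrite /cis cosN sinN. Qed.

Lemma cis0 : cis (0 : R) = 1.
Proof. by rewrite /cis cos0 sin0. Qed.

Lemma charDl s t x : char (s + t) x = char s x * char t x.
Proof. by rewrite /char -cisD; congr cis; ring. Qed.

Lemma charDr t x y : char t (x + y) = char t x * char t y.
Proof. by rewrite /char -cisD; congr cis; ring. Qed.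

Lemma charN t x : char (- t) x = ((char t x)^*)%C.
Proof. by rewrite /char -cisN; congr cis; ring. Qed.

Lemma char0 x : char 0 x = 1.
Proof. by rewrite /char mulr0 mul0r oppr0 cis0. Qed.

Lemma bounded_cos_lin (a : R) : bmeas (fun x : R => cos (a * x)).
Proof.
split; last by exists 1 => x; rewrite ler_norml cos_geN1 cos_le1.
apply: continuous_measurable_fun => x.
apply: continuous_comp; [exact: mulrl_continuous|exact: continuous_cos].
Qed.

Lemma bounded_sin_lin (a : R) : bmeas (fun x : R => sin (a * x)).
Proof.
split; last by exists 1 => x; rewrite ler_norml sin_geN1 sin_le1.
apply: continuous_measurable_fun => x.
apply: continuous_comp; [exact: mulrl_continuous|exact: continuous_sin].
Qed.

Lemma cbmeas_char t : cbmeas (char t).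
Proof.
split; rewrite /char/=.
  by under eq_fun do rewrite -mulNr; exact: bounded_cos_lin.
by under eq_fun do rewrite -mulNr; exact: bounded_sin_lin.
Qed.

Lemma char_fun0 (m : probability R R) : char_fun m 0 = 1.
Proof.
rewrite /char_fun (_ : char 0 = fun=> 1); last by apply/funext => x; exact: char0.
rewrite cint_cst (_ : (m : {measure set R -> \bar R}) _ = 1%E) ?mulr1//.
exact: probability_setT.
Qed.

Lemma char_funN (m : {finite_measure set R -> \bar R}) t :
  char_fun m (- t) = ((char_fun m t)^*)%C.
Proof.
rewrite /char_fun -cint_conj; last exact: cbmeas_char.
by congr cint; apply/funext => x; exact: charN.
Qed.

End characteristic_function.

Section bessel.
Variable R : realType.
Variable m : probability R R.

(** Pythagoras for the projection on finitely many orthonormal exponentials: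
    the choice [c i = char_fun m (s - i)] gives Bessel's inequality, while an
    arbitrary [c], as provided by completeness, bounds the sum of the squared
    coefficients from below. *)
Lemma residual_norm (s : R) (F : seq R) (c : R -> R[i]) :
  uniq F -> {in F &, forall i j, i != j -> char_fun m (i - j) = 0} ->
  let f x := char s x - \sum_(i <- F) c i * char i x in
  cint m (fun x => f x * (f x)^*%C) =
  (1 - \sum_(i <- F) sqnorm (char_fun m (s - i)) +
   \sum_(i <- F) sqnorm (c i - char_fun m (s - i)))%:C%C.
Proof.
move=> uF oF f.
have charB (i j x : R) : char i x * ((char j x)^*)%C = char (i - j) x.
  by rewrite charDl charN.
have fE x : f x * ((f x)^*)%C = 1 + (\sum_(i <- F) (
   \sum_(j <- F) c i * (c j)^*%C * char (i - j) x
   + (- (c i)^*%C * char (s - i) x + - c i * char (i - s) x))).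
  rewrite /f rmorphB mulrBl !mulrBr charB subrr char0 -addrA; congr (1 + _).
  rewrite big_split big_split/= rmorph_sum opprB addrCA; congr (_ + _).
    rewrite mulr_sumr -sumrN; apply: eq_bigr => i _.
    by rewrite rmorphM -charB /=; ring.
  congr (_ + _).
    rewrite mulr_suml; apply: eq_bigr => i _; rewrite mulr_sumr.
    by apply: eq_bigr => j _; rewrite rmorphM -charB /=; ring.
  rewrite mulr_suml -sumrN; apply: eq_bigr => i _.
  by rewrite -charB /=; ring.
have bc (k : R[i]) t : cbmeas (fun x => k * char t x).
  by apply: cbmeasM; [exact: cbmeas_cst|exact: cbmeas_char].
under eq_fun do rewrite fE.
rewrite cintD; [|exact: cbmeas_cst|]; last first.
  apply: cbmeas_sum => i; apply: cbmeasD; first exact: cbmeas_sum.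
  by apply: cbmeasD.
rewrite cint_sum; last first.
  move=> i; apply: cbmeasD; first exact: cbmeas_sum.
  by apply: cbmeasD.
have -> : cint m (fun=> 1) = 1.
  rewrite -[RHS](char_fun0 m) /char_fun; congr (cint _ _).
  by apply/funext => x; rewrite char0.
rewrite -[RHS]/((real_complex R) _) rmorphD rmorphB rmorph1 !rmorph_sum /=.
rewrite -addrA; congr (1 + _); rewrite -sumrN -big_split/=.
rewrite big_seq [RHS]big_seq; apply: eq_bigr => i iF.
rewrite cintD; [|exact: cbmeas_sum|exact: cbmeasD].
rewrite cint_sum// cintD// !cintZ; try exact: cbmeas_char.
rewrite -!/(char_fun m _) -[i - s]opprB char_funN.
have -> : \sum_(j <- F) cint m (fun x => c i * ((c j)^*)%C * char (i - j) x) =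
   c i * ((c i)^*)%C.
  rewrite (bigD1_seq i)//= cintZ; last exact: cbmeas_char.
  rewrite -/(char_fun m _) subrr char_fun0 mulr1 big_seq_cond big1 ?addr0//.
  move=> j /andP[jF ji]; rewrite cintZ; last exact: cbmeas_char.
  by rewrite -/(char_fun m _) oF ?mulr0// eq_sym.
rewrite -(mul_conjc (c i - _)) -(mul_conjc (char_fun m _)) rmorphB /=; ring.
Qed.

Lemma Re_cint_ge0 (f : R -> R[i]) :
  0 <= complex.Re (cint m (fun x => f x * (f x)^*%C)).
Proof.
apply: Rintegral_ge0 => x _; rewrite mul_conjc /=.
exact: sqnorm_ge0.
Qed.

Lemma bessel (s : R) (F : seq R) :
  uniq F -> {in F &, forall i j, i != j -> char_fun m (i - j) = 0} ->
  \sum_(i <- F) sqnorm (char_fun m (s - i)) <= 1.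
Proof.
move=> uF oF; have := Re_cint_ge0
  (fun x => char s x - \sum_(i <- F) char_fun m (s - i) * char i x).
rewrite (residual_norm s (fun i => char_fun m (s - i)) uF oF) /=.
by rewrite [X in _ + X]big1 ?addr0 ?subr_ge0// => i _; rewrite subrr sqnorm0.
Qed.

Lemma orthogonal_esum_le1 (L : set R) (s : R) :
  (forall i j, L i -> L j -> i != j -> char_fun m (i - j) = 0) ->
  (\esum_(l in L) (sqnorm (char_fun m (s - l)))%:E <= 1)%E.
Proof.
move=> oL; apply: ge_ereal_sup => _ [X [finX XL] <-].
rewrite fsbig_finite//= sumEFin lee_fin; apply: bessel; first exact: fset_uniq.
by move=> i j; rewrite !in_fset_set// !inE => /XL Li /XL Lj; exact: oL.
Qed.

End bessel.

Section spectral.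
Variables (R : realType) (m : probability R R).

Lemma bmeas_Lfun2 (f : R -> R) : bmeas f -> f \in Lfun m 2%:E.
Proof.
move=> bf; have [mf _] := bf.
rewrite inE; apply/andP; split; rewrite inE//=.
rewrite /finite_norm unlock poweR_lty//.
have /integrable_lty : m.-integrable setT (EFin \o (fun x => f x * f x)).
  by apply: bmeas_integrable; exact: bmeasM.
move=> /(_ measurableT); apply: le_lt_trans; rewrite le_eqVlt; apply/orP; left.
apply/eqP; apply: eq_integral => x _ /=.
by rewrite powR_mulrn// real_normK ?num_real// expr2.
Qed.

Lemma char_L2 t : L2_complex m (char t).
Proof. by have [rf jf] := cbmeas_char t; split; exact: bmeas_Lfun2. Qed.

(** Completeness, applied to [char s], makes the residual of [residual_norm]
    arbitrarily small, so the coefficients of [char s] exhaust its norm. *)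
Lemma spectral_parseval (L : set R) :
  orthonormal_basis_on m L (fun l x => cis (- (2 * pi * l * x))) ->
  (forall i j, L i -> L j -> i != j -> char_fun m (i - j) = 0) /\
  forall s, (\esum_(l in L) (sqnorm (char_fun m (s - l)))%:E = 1)%E.
Proof.
move=> [[_ oL] cL].
have oL' i j : L i -> L j -> i != j -> char_fun m (i - j) = 0.
  move=> Li Lj ij; have := oL i j Li Lj; rewrite (negbTE ij) => h; apply: etrans h.
  rewrite /inner_product; congr (cint m _); apply/funext => x.
  by rewrite charDl charN.
split => // s; apply/eqP; rewrite eq_le orthogonal_esum_le1//=.
apply/lee_addgt0Pr => e e0.
have [F [c [FL]]] := cL (char s) (char_L2 s) (Num.sqrt e) (etrans (sqrtr_gt0 _) e0).
rewrite /L2_norm ltr_sqrt//.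
rewrite -[inner_product _ _ _]/(cint m (fun x =>
  (char s x - \sum_(i <- F) c i * char i x) *
  (char s x - \sum_(i <- F) c i * char i x)^*%C)).
rewrite residual_norm; [|exact: fset_uniq|]; last first.
  by move=> i j iF jF; apply: oL'; exact: FL.
rewrite /= => lte.
apply: (@le_trans _ _
  ((\sum_(i <- F) sqnorm (char_fun m (s - i)))%:E + e%:E)%E).
  rewrite -EFinD lee_fin.
  have : 0 <= \sum_(i <- F) sqnorm (c i - char_fun m (s - i)).
    by apply: sumr_ge0 => i _; exact: sqnorm_ge0.
  by move: lte; lra.
apply: leeD2r; apply: esum_ge; exists [set` F].
  by split => //; exact: finite_fset.
by rewrite fsbig_finite//= set_fsetK sumEFin.
Qed.

End spectral.

(** * Infinite convolutions as products of masks *)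

Section char_fun_convolution.
Variable R : realType.

Lemma Rintegral_convolution (mu nu : {finite_measure set R -> \bar R}) (f : R -> R) :
  bmeas f ->
  \int[convolution mu nu]_x f x = \int[(mu \x nu)%E]_z f (z.1 + z.2).
Proof.
move=> bf.
have madd : measurable_fun [set: R * R] (fun p : R * R => p.1 + p.2).
  exact: measurable_funD.
rewrite /Rintegral /convolution integral_pushforward//.
- have [mf _] := bf; exact/measurable_EFinP.
- rewrite preimage_setT.
  by apply: bmeas_integrable_lty; [exact: product_measure_lty|exact: bmeas_comp].
Qed.

Lemma Rintegral_uniform_measure (A : {fset R}) (f : R -> R) :
  measurable_fun setT f ->
  \int[uniform_measure A]_x f x = (#|` A|%fset)%:R^-1 * \sum_(a <- A) f a.
Proof.
move=> mf; rewrite /Rintegral integralE.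
(* The integration lemmas for scaled and summed measures are about
   nonnegative functions: treat the two parts of [f] separately. *)
have E (g : R -> \bar R) : measurable_fun setT g -> (forall x, 0 <= g x)%E ->
   (\int[uniform_measure A]_x g x = (#|` A|%fset)%:R^-1%:E * \sum_(a <- A) g a)%E.
  move=> mg g0; rewrite ge0_integral_mscale// ge0_integral_measure_sum//.
  congr (_ * _)%E; rewrite (big_nth 0) big_mkord.
  by apply: eq_bigr => i _; rewrite integral_dirac// diracT mul1e.
have mf' : measurable_fun setT (EFin \o f) by exact/measurable_EFinP.
rewrite (_ : (fun x => (f x)%:E) = EFin \o f)// !E//; first last.
- exact: measurable_funepos.
- exact: measurable_funeneg.
have P a : ((EFin \o f)^\+ a)%E = (Num.max (f a) 0)%:E by rewrite funeposE EFin_max.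
have Q a : ((EFin \o f)^\- a)%E = (Num.max (- f a) 0)%:E
  by rewrite funenegE EFin_max EFinN.
under eq_bigr do rewrite P.
under [X in (_ - _ * X)%E]eq_bigr do rewrite Q.
rewrite !sumEFin -!EFinM -EFinB /= -mulrBr -sumrB; congr (_ * _).
by apply: eq_bigr => a _; case: (lerP (f a) 0) => ?; case: (lerP (- f a) 0) => ?; lra.
Qed.

Lemma char_fun_convolution (mu nu : {finite_measure set R -> \bar R}) t :
  char_fun (convolution mu nu) t = char_fun mu t * char_fun nu t.
Proof.
rewrite /char_fun; have := charDr t; move: (char t) (cbmeas_char t) => h [bre bim] hD.
have E x y : (complex.Re (h (x + y)) = complex.Re (h x) * complex.Re (h y) -
     complex.Im (h x) * complex.Im (h y)) /\
   (complex.Im (h (x + y)) = complex.Re (h x) * complex.Im (h y) +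
     complex.Im (h x) * complex.Re (h y)).
  by rewrite hD; case: (h x) (h y) => ? ? [].
have I12 (f g : R -> R) : bmeas f -> bmeas g ->
   (mu \x nu)%E.-integrable setT (EFin \o (fun z : R * R => f z.1 * g z.2)).
  move=> bf bg; apply: bmeas_integrable_lty; first exact: product_measure_lty.
  by apply: bmeasM; [apply: (bmeas_comp (h := fst))|apply: (bmeas_comp (h := snd))].
apply/eqP; rewrite eq_complex /cint /= !Rintegral_convolution//.
rewrite -!Rintegral_prod//; apply/andP; split; apply/eqP.
  rewrite -RintegralB//; [|exact: (I12 _ _ bre bre)|exact: (I12 _ _ bim bim)].
  by apply: eq_Rintegral => z _; case: (E z.1 z.2).
rewrite -RintegralD//; [|exact: (I12 _ _ bre bim)|exact: (I12 _ _ bim bre)].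
by apply: eq_Rintegral => z _; case: (E z.1 z.2).
Qed.

Lemma char_fun_uniform_measure (A : {fset R}) t :
  char_fun (uniform_measure A) t = (#|` A|%fset)%:R^-1 * \sum_(a <- A) char t a.
Proof.
have [[mre _] [mim _]] := cbmeas_char t.
rewrite /char_fun /cint !Rintegral_uniform_measure//.
transitivity (((#|` A|%fset)%:R^-1 : R)%:C%C * \sum_(a <- A) char t a); last first.
  by rewrite -[_%:C%C]/(real_complex R _) fmorphV rmorph_nat.
have -> (s : seq R) :
    \sum_(a <- s) char t a = Complex (\sum_(a <- s) complex.Re (char t a))
    (\sum_(a <- s) complex.Im (char t a)).
  elim: s => [|a s ih]; first by rewrite !big_nil.
  by rewrite !big_cons ih; case: (char t a).
by apply/eqP; rewrite eq_complex /= !mul0r subr0 addr0 !eqxx.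
Qed.

End char_fun_convolution.

Section recursion.
Variable R : realType.

(** The characteristic function of the uniform probability on [B]. *)
Definition mask (B : {fset int}) (t : R) : R[i] :=
  (#|` B|%fset)%:R^-1 * \sum_(b <- B) char t b%:~R.

Lemma char_scale (t x a : R) : char t (x / a) = char (t / a) x.
Proof. by rewrite /char; congr cis; ring. Qed.

Variables (N : nat -> nat) (B : nat -> {fset int}).
Hypothesis N_gt0 : forall i, (1 <= i)%N -> (0 < N i)%N.

Lemma scale_neq0 k j : (\prod_(k.+1 <= i < j.+1) N i)%:R != 0 :> R.
Proof.
rewrite pnatr_eq0 -lt0n big_nat_cond; apply: prodn_cond_gt0 => i.
by rewrite andbT => /andP[ki _]; apply: N_gt0; exact: leq_ltn_trans ki.
Qed.

Lemma char_fun_scaled_digits k j t :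
  char_fun (uniform_measure (scaled_digits N B k j)) t =
  mask (B j) (t / (\prod_(k.+1 <= i < j.+1) N i)%:R).
Proof.
have inj : {in B j &, injective
    (fun b : int => b%:~R / (\prod_(k.+1 <= i < j.+1) N i)%:R : R)}.
  move=> b b' _ _ /(mulIf (invr_neq0 (scale_neq0 k j))) /eqP.
  by rewrite eqr_int => /eqP.
rewrite char_fun_uniform_measure /mask /scaled_digits card_in_imfset//.
rewrite big_imfset//=; congr (_ * _); apply: eq_bigr => b _.
exact: char_scale.
Qed.

Lemma char_fun_dirac0 (t : R) : char_fun \d_(0 : R) t = 1.
Proof.
have [[mre _] [mim _]] := cbmeas_char t.
rewrite /char_fun /cint /Rintegral !integral_dirac//; try exact/measurable_EFinP.
by rewrite !diracT !mul1e /= /cis mulr0 oppr0 cos0 sin0.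
Qed.

Lemma char_fun_partial_convolution k n (t : R) :
  char_fun (partial_convolution N B k n) t =
  \prod_(j < n) mask (B (k + j.+1)) (t / (\prod_(k.+1 <= i < (k + j.+1).+1) N i)%:R).
Proof.
elim: n => [|n ih]; first by rewrite big_ord0 char_fun_dirac0.
by rewrite big_ord_recr -ih /= -char_fun_scaled_digits -char_fun_convolution.
Qed.

(** The finite convolutions are built by adding the finest scale last, while
    the recursion between the tails takes the coarsest scale out first: the
    product formula allows passing from one to the other. *)
Lemma char_fun_partial_convolutionS k n (t : R) :
  char_fun (partial_convolution N B k n.+1) t =
  mask (B k.+1) (t / (N k.+1)%:R) *
  char_fun (partial_convolution N B k.+1 n) (t / (N k.+1)%:R).
Proof.
rewrite !char_fun_partial_convolution big_ord_recl /= addn1 big_nat1; congr (_ * _).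
apply: eq_bigr => j _; rewrite /bump/= add1n addSnnS; congr (mask _ _).
rewrite [in LHS]big_ltn//; last by lia.
by rewrite natrM invfM mulrA.
Qed.

Lemma char_fun_weak_cvg (m_ : nat -> {measure set R -> \bar R})
    (m : {measure set R -> \bar R}) (t : R) : weak_cvg m_ m ->
  (complex.Re (char_fun (m_ n) t) @[n --> \oo] --> complex.Re (char_fun m t)) /\
  (complex.Im (char_fun (m_ n) t) @[n --> \oo] --> complex.Im (char_fun m t)).
Proof.
have clin : continuous (fun x : R => - (2 * pi * t * x)).
  rewrite (_ : (fun _ => _) = (fun x => - (2 * pi * t) * x)).
    exact: mulrl_continuous.
  by apply/funext => x; rewrite mulNr.
move=> cvm; split; apply: cvm.
- move=> x; apply: continuous_comp; last exact: continuous_cos.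
  exact: clin.
- by exists 1; split => // K K1 x _ /=;
    rewrite (le_trans _ (ltW K1))// ler_norml cos_geN1 cos_le1.
- move=> x; apply: continuous_comp; last exact: continuous_sin.
  exact: clin.
- by exists 1; split => // K K1 x _ /=;
    rewrite (le_trans _ (ltW K1))// ler_norml sin_geN1 sin_le1.
Qed.

(** The functional equation of the tails; it survives the weak limit because
    the mask in front does not depend on the number of factors. *)
Lemma char_fun_tail k (mu nu : probability R R) (t : R) :
  is_tail_convolution N B k mu -> is_tail_convolution N B k.+1 nu ->
  char_fun mu t = mask (B k.+1) (t / (N k.+1)%:R) * char_fun nu (t / (N k.+1)%:R).
Proof.
move=> hmu hnu.
have [reu imu] := char_fun_weak_cvg t hmu.
have [rev imv] := char_fun_weak_cvg (t / (N k.+1)%:R) hnu.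
rewrite -cvg_shiftS /= in reu; rewrite -cvg_shiftS /= in imu.
have E n := char_fun_partial_convolutionS k n t.
move: (mask _ _) E => [a b] E.
apply/eqP; rewrite eq_complex; apply/andP; split; apply/eqP.
- apply: (cvg_unique _ reu) => //.
  rewrite (_ : (fun n => _) = (fun n =>
    a * complex.Re (char_fun (partial_convolution N B k.+1 n) (t / (N k.+1)%:R)) -
    b * complex.Im (char_fun (partial_convolution N B k.+1 n) (t / (N k.+1)%:R)))).
    rewrite (_ : complex.Re _ = a * complex.Re (char_fun nu (t / (N k.+1)%:R)) -
      b * complex.Im (char_fun nu (t / (N k.+1)%:R))).
      by apply: cvgB; apply: cvgMr.
    by case: (char_fun nu _).
  apply/funext => n; apply: etrans (congr1 (@complex.Re R) (E n)) _.
  by case: (char_fun (partial_convolution N B k.+1 n) _).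
- apply: (cvg_unique _ imu) => //.
  rewrite (_ : (fun n => _) = (fun n =>
    a * complex.Im (char_fun (partial_convolution N B k.+1 n) (t / (N k.+1)%:R)) +
    b * complex.Re (char_fun (partial_convolution N B k.+1 n) (t / (N k.+1)%:R)))).
    rewrite (_ : complex.Im _ = a * complex.Im (char_fun nu (t / (N k.+1)%:R)) +
      b * complex.Re (char_fun nu (t / (N k.+1)%:R))).
      by apply: cvgD; apply: cvgMr.
    by case: (char_fun nu _).
  apply/funext => n; apply: etrans (congr1 (@complex.Im R) (E n)) _.
  by case: (char_fun (partial_convolution N B k.+1 n) _).
Qed.
End recursion.

(** * Masks of complete residue systems *)

Section roots_of_unity.
Variable R : realType.

Lemma cis_nat (n : nat) : cis (2 * pi * n%:R : R) = 1.
Proof.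
elim: n => [|n ih]; first by rewrite mulr0 cis0.
rewrite -[n.+1%:R]natr1 mulrDr cisD ih mul1r mulr1 /cis.
by rewrite mulrC mulr_natr cos2pi sin2pi.
Qed.

Lemma cis_int (k : int) : cis (2 * pi * k%:~R : R) = 1.
Proof.
case: k => n; first exact: cis_nat.
by rewrite NegzE mulrNz mulrN cisN cis_nat rmorph1.
Qed.

Lemma char_int (t x : R) (k : int) : t * x = k%:~R -> char t x = 1.
Proof. by move=> tx; rewrite /char -mulrA tx cisN cis_int rmorph1. Qed.

Lemma char_eq1 (t x : R) : char t x = 1 -> exists k : int, t * x = k%:~R.
Proof.
move=> h; set y := t * x; exists (Num.floor y).
have : cis (2 * pi * (y - (Num.floor y)%:~R)) = 1.
  rewrite mulrBr cisD cisN cis_int rmorph1 mulr1.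
  by rewrite -[LHS]conjcK -cisN /y mulrA -/(char t x) h rmorph1.
set z := y - _ => /eqP; rewrite eq_complex /= => /andP[/eqP cz _].
have z0 : 0 <= z by rewrite subr_ge0 Num.Theory.floor_le.
have z1 : z < 1 by have := Num.Theory.floorD1_gt y; rewrite intrD /z; lra.
have sz : sin (pi * z) = 0.
  have := cos2sin2 (pi * z); have := cos_mulr2n (pi * z).
  rewrite (_ : (pi * z) *+ 2 = 2 * pi * z); last by rewrite -mulr_natl mulrA.
  rewrite cz => c1 c2; apply/eqP; rewrite -sqrf_eq0; apply/eqP; move: c1 c2.
  by rewrite -mulr_natl; lra.
move: z0; rewrite le_eqVlt => /orP[/eqP z0|z0].
  by apply/eqP; rewrite -subr_eq0 -/z -z0.
have : 0 < sin (pi * z).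
  by apply: sin_gt0_pi; rewrite mulr_gt0 ?pi_gt0//= gtr_pMr ?pi_gt0.
by rewrite sz ltxx.
Qed.

Lemma charX (t x : R) n : char t x ^+ n = char t (x * n%:R).
Proof.
elim: n => [|n ih]; first by rewrite expr0 mulr0 /char mulr0 oppr0 cis0.
by rewrite exprS ih -charDr; congr char; rewrite -natr1; ring.
Qed.

Lemma sum_char_ord (M : nat) (t : R) (k : int) : t * M%:R = k%:~R ->
  (forall j : int, t != j%:~R) -> \sum_(i < M) char t i%:R = 0.
Proof.
move=> tM tZ; have /eqP := subrX1 (char t 1) M.
rewrite charX mul1r (char_int tM) subrr eq_sym mulf_eq0 => /orP[|/eqP h].
  rewrite subr_eq0 => /eqP /char_eq1[j]; rewrite mulr1 => tj.
  by have := tZ j; rewrite tj eqxx.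
by rewrite -[RHS]h; apply: eq_bigr => i _; rewrite charX mul1r.
Qed.

Variables (M : nat) (B : {fset int}).
Hypothesis M_gt0 : (0 < M)%N.
Hypothesis hB : complete_residue_system M B.

Let M0 : M%:R != 0 :> R. Proof. by rewrite pnatr_eq0 -lt0n. Qed.

Lemma residue_inj (b b' : int) : b \in B -> b' \in B ->
  (b = b' %[mod M%:Z])%Z -> b = b'.
Proof.
move=> bB b'B bb'; have [_ /(_ b') [c [_ uc]]] := hB.
by rewrite -(uc b) ?(uc b').
Qed.

(** Expanding the squares leaves the pairs [(b, b')] with the sum of the
    [M]-th roots of unity to the power [b' - b], which vanishes unless
    [b = b'] because distinct elements of [B] are incongruent. *)
Lemma sum_mask_translates (t : R) :
  \sum_(i < M) sqnorm (mask B (t - i%:R / M%:R)) = 1.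
Proof.
apply: (@complexI R); rewrite rmorph_sum rmorph1 /=.
have [cM _] := hB.
have E (i : 'I_M) : (sqnorm (mask B (t - i%:R / M%:R)))%:C%C = (M%:R^-1 * M%:R^-1) *
    \sum_(b <- B) \sum_(b' <- B) char t (b%:~R - b'%:~R) *
      char ((b'%:~R - b%:~R) / M%:R) i%:R.
  rewrite -mul_conjc /mask cM [((_ * _)^*)%C]rmorphM fmorphV rmorph_nat mulrACA.
  rewrite rmorph_sum mulr_suml; congr (_ * _); apply: eq_bigr => b _.
  rewrite mulr_sumr; apply: eq_bigr => b' _.
  rewrite -[X in _ * X]/((char _ _)^*)%C -charN /char -!cisD; congr cis.
  by field.
have S (b b' : int) : b \in B -> b' \in B ->
    \sum_(i < M) char t (b%:~R - b'%:~R) * char ((b'%:~R - b%:~R) / M%:R) i%:R =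
    if b == b' then M%:R else 0.
  move=> bB b'B; rewrite -mulr_sumr; case: eqVneq => [->|bb'].
    rewrite subrr mul0r /char mulr0 oppr0 cis0 mul1r.
    under eq_bigr do rewrite mulr0 mul0r oppr0 cis0.
    by rewrite sumr_const card_ord.
  rewrite (@sum_char_ord M _ (b' - b)) ?mulr0// ?rmorphB ?divfK// => j.
  apply/eqP => h; move/negP: bb'; apply; apply/eqP; apply: residue_inj => //.
  have : ((b' - b)%:~R : R) = (j * M%:Z)%:~R.
    by rewrite rmorphB rmorphM /= -h divfK.
  move/eqP; rewrite eqr_int => /eqP h'.
  apply/eqP; rewrite eq_sym eqz_mod_dvd h'; exact: dvdz_mull.
under eq_bigr do rewrite E.
rewrite -mulr_sumr exchange_big /=.
rewrite (eq_big_seq (fun=> M%:R)); last first.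
  move=> b bB; rewrite exchange_big /= (bigD1_seq b) ?fset_uniq//=.
  rewrite S// eqxx.
  rewrite big_seq_cond big1 ?addr0// => b' /andP[b'B bb'].
  by rewrite S// eq_sym (negbTE bb').
rewrite /= big_const_seq count_predT iter_addr_0 -[size _]/(#|` B|%fset) cM.
rewrite -mulr_natr; field.
by rewrite pnatr_eq0 -lt0n.
Qed.

Lemma fset_min_le (b : int) : b \in B -> fset_min B <= b.
Proof. by move=> bB; exact: (ge_bigmin_seq _ b xpredT id). Qed.

(** The quotient that defines the character polynomial is exact: modulo
    ['X^M - 1], hence modulo the geometric sum, the exponents can be reduced
    modulo [M], and they then run through [0, ..., M - 1]. *)
Lemma geometric_dvdp :
  ((\sum_(k < #|` B|%fset) 'X^k : {poly R[i]}) %|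
   \sum_(b <- B) 'X^(absz (b - fset_min B)))%R.
Proof.
have [cM _] := hB; rewrite cM; set q := \sum_(k < M) _.
pose e (b : int) := absz (b - fset_min B).
have dX b : (q %| 'X^(e b) - 'X^(e b %% M))%R.
  rewrite {1}(divn_eq (e b) M) exprD mulnC exprM -[X in _ - X]mul1r -mulrBl.
  by rewrite subrX1 subrX1 -/q; do 2!apply: dvdp_mulr; exact: dvdp_mull.
rewrite (_ : \sum_(b <- B) _ = \sum_(b <- B) ('X^(e b) - 'X^(e b %% M)) + q).
  by rewrite dvdp_addl ?dvdpp//; elim/big_ind: _ => //; exact: dvdp_add.
have eE (b : int) : b \in B -> (e b)%:Z = b - fset_min B.
  by move=> bB; rewrite /e gez0_abs// subr_ge0 fset_min_le.
have um : uniq [seq (e b %% M)%N | b <- B].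
  rewrite map_inj_in_uniq ?fset_uniq// => b b' bB b'B h; apply: residue_inj => //.
  apply/eqP; rewrite -(eqz_modDr (- fset_min B)) -!eE//.
  by rewrite !modz_nat h.
have pm : perm_eq [seq (e b %% M)%N | b <- B] (iota 0 M).
  apply: uniq_perm => //; first exact: iota_uniq.
  have [] := uniq_min_size um (s2 := iota 0 M).
  - move=> k /mapP[b _ ->]; rewrite mem_iota/= add0n ltn_mod//.
  - by rewrite size_iota size_map -cM.
  - by [].
rewrite sumrB (_ : \sum_(b <- B) 'X^(e b %% M) = q) ?subrK//.
transitivity (\sum_(k <- [seq (e b %% M)%N | b <- B]) ('X^k : {poly R[i]})).
  by rewrite big_map.
by rewrite (perm_big _ pm) /= -{1}[M]subn0 -/(index_iota 0 M) big_mkord.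
Qed.

(** Up to a factor of modulus 1, the mask is the product of the character
    polynomial and of the geometric sum; the zeros of the latter on the unit
    circle are [M]-th roots of unity. *)
Lemma mask_zero (t : R) : uniform_discrete_zero R M B -> mask B t = 0 ->
  exists k : int, t * M%:R = k%:~R.
Proof.
move=> uz mt; have [cM _] := hB.
pose z : R[i] := char t 1.
have pz : (\sum_(b <- B) 'X^(absz (b - fset_min B)) : {poly R[i]}).[z] = 0.
  rewrite horner_sum.
  transitivity (char t (- (fset_min B)%:~R) * \sum_(b <- B) char t b%:~R).
    rewrite mulr_sumr; apply: eq_big_seq => b bB.
    rewrite hornerXn charX mul1r -charDr; congr char.
    rewrite -[LHS]/((absz (b - fset_min B))%:Z%:~R) gez0_abs ?subr_ge0 ?fset_min_le//.
    by rewrite rmorphB addrC.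
  move/eqP: mt; rewrite mulf_eq0 invr_eq0 cM pnatr_eq0 -leqn0 leqNgt M_gt0 /=.
  by move=> /eqP ->; rewrite mulr0.
have := divpK geometric_dvdp; rewrite -/(character_polynomial B) => fq.
move: pz; rewrite -fq hornerM => /eqP; rewrite mulf_eq0 => /orP[/eqP fz|/eqP qz].
  have : zero_set (fun x : R => (@character_polynomial R B).[cis (- (2 * pi * x))]) t.
    by rewrite /zero_set/= -fz /z /char mulr1.
  by move=> /uz [j _ <-]; exists j; rewrite divfK.
apply: (@char_eq1 t M%:R); apply/eqP; rewrite -[M%:R]mul1r -charX -subr_eq0 subrX1.
move: qz; rewrite cM horner_sum (eq_bigr (fun i : 'I_M => z ^+ i)) => [->|i _].
  by rewrite mulr0.
by rewrite hornerXn.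
Qed.

End roots_of_unity.

(** * Characteristic functions near the origin *)

Section nonvanishing.
Variable R : realType.

Lemma continuous_Re_char_fun0 (m : probability R R) :
  {for 0, continuous (fun t => complex.Re (char_fun m t))}.
Proof.
have := @continuity_under_integral R _ R m (fun t x => cos (- (2 * pi * t * x)))
  setT measurableT (-1) 1 _ _ (fun=> 1) _ _ 0.
apply.
- by move=> t _; have [re _] := cbmeas_char t; exact: bmeas_integrable.
- apply/aeW => x _ t _; apply: continuous_comp; last exact: continuous_cos.
  rewrite (_ : (fun _ => _) = (fun t => - (2 * pi * x) * t)).
    exact: mulrl_continuous.
  by apply/funext => u; ring.
- by apply: bmeas_integrable; exact: bmeas_cst.
- by move=> t _; apply/aeW => x _; rewrite ler_norml cos_geN1 cos_le1.
- by rewrite inE /= in_itv /=; lra.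
Qed.

(** The descent only controls the Parseval sums outside a countable set of
    translations; this lemma provides a translation outside that set for which
    a prescribed point has positive mass. *)
Lemma char_fun_neq0_off_countable (m : probability R R) (E : set R) :
  countable E -> exists2 t, ~ E t & char_fun m t != 0.
Proof.
move=> cE.
have c1 : complex.Re (char_fun m 0) = 1 by rewrite char_fun0.
have cv : complex.Re (char_fun m t) @[t --> (0 : R)] --> complex.Re (char_fun m 0).
  exact: continuous_Re_char_fun0.
have [e /= e0 he] : \forall t \near (0 : R), 0 < complex.Re (char_fun m t).
  by apply: (cvgr_gt _ cv); rewrite c1.
have [t [te nEt]] : exists t, `]0, e[%classic t /\ ~ E t.
  apply: contrapT => h.
  have sub : `]0, e[%classic `<=` E.
    by move=> t te; apply: contrapT => nE; apply: h; exists t.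
  have := countable_lebesgue_measure0 (sub_countable (subset_card_le sub) cE).
  rewrite lebesgue_measure_itv /= lte_fin e0 -EFinB subr0 => -[] e00.
  by rewrite e00 ltxx in e0.
exists t => //; have h : 0 < complex.Re (char_fun m t).
  apply: he; rewrite /ball_ /= sub0r normrN.
  by move: te; rewrite /= in_itv /= => /andP[t0 te]; rewrite gtr0_norm.
by apply: contraTneq h => ->; rewrite ltxx.
Qed.

End nonvanishing.

(** * Descent along one scale *)

Section cells.
Variables (R : realType) (d : R) (M : nat).
Hypotheses (d_gt0 : 0 < d) (M_gt0 : (0 < M)%N).

(** The representative of [x] modulo [d] with [0 <= cell_base x < d]. *)
Definition cell_base (x : R) : R := x - d * (Num.floor (x / d))%:~R.

Let cell_idx_subproof (x : R) : (absz (Num.floor (x / d) %% M%:Z)%Z < M)%N.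
Proof.
by rewrite -ltz_nat gez0_abs ?modz_ge0 ?ltz_pmod// gt_eqF.
Qed.

(** Together with [cell_base], this coordinate determines [x] modulo
    [d * M]. *)
Definition cell_idx (x : R) : 'I_M := Ordinal (cell_idx_subproof x).

Let d0 : d != 0. Proof. by rewrite gt_eqF. Qed.

Lemma floor_shift (x y : R) (k : int) : x - y = d * k%:~R ->
  Num.floor (x / d) = Num.floor (y / d) + k.
Proof.
move=> xy; rewrite (_ : x / d = y / d + k%:~R).
  by rewrite Num.Theory.floorDrz ?intr_int// Num.Theory.intrKfloor.
by rewrite -[x](subrK y) xy mulrDl addrC mulrAC divff// mul1r.
Qed.

Lemma cell_baseP (x y : R) :
  cell_base x = cell_base y <-> exists k : int, x - y = d * k%:~R.
Proof.
split=> [h|[k xy]].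
  exists (Num.floor (x / d) - Num.floor (y / d)).
  by move: h; rewrite /cell_base rmorphB /= mulrBr; lra.
rewrite /cell_base (floor_shift xy) rmorphD /= mulrDr -xy; ring.
Qed.

Lemma cell_idxP (x y : R) (k : int) : x - y = d * k%:~R ->
  cell_idx x = cell_idx y <-> (M%:Z %| k)%Z.
Proof.
move=> xy.
rewrite (_ : (M%:Z %| k)%Z = (Num.floor (x / d) == Num.floor (y / d) %[mod M%:Z])%Z).
  split => [/(congr1 val) /= h|/eqP h]; last by apply: val_inj; rewrite /= h.
  apply/eqP; move: (congr1 Posz h).
  by rewrite !gez0_abs ?modz_ge0 ?gt_eqF.
by rewrite eqz_mod_dvd (floor_shift xy) addrC addKr.
Qed.

Lemma cell_decomp (x : R) : exists z : int,
  x = cell_base x + d * (cell_idx x)%:R + d * M%:R * z%:~R.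
Proof.
exists (Num.floor (x / d) %/ M%:Z)%Z.
have := divz_eq (Num.floor (x / d)) M%:Z => h.
have E : ((cell_idx x)%:R : R) = (Num.floor (x / d) %% M%:Z)%Z%:~R.
  by rewrite -[LHS]/((Posz _)%:~R) /= gez0_abs ?modz_ge0 ?gt_eqF.
rewrite /cell_base E {1}h rmorphD rmorphM /=; ring.
Qed.

End cells.

Section step.
Variables (R : realType) (p M : nat) (B : {fset int}).
Hypotheses (p_gt0 : (0 < p)%N) (M_gt0 : (0 < M)%N).
Hypotheses (hB : complete_residue_system M B) (uz : uniform_discrete_zero R M B).

Definition orthogonal (phi : R -> R[i]) (L : set R) :=
  forall i j, L i -> L j -> i != j -> phi (i - j) = 0.

Definition bessel_bound (phi : R -> R[i]) := forall (L : set R) s,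
  orthogonal phi L -> (\esum_(l in L) (sqnorm (phi (s - l)))%:E <= 1)%E.

Definition parseval (phi : R -> R[i]) (E L : set R) :=
  orthogonal phi L /\
  forall s, ~ E s -> (\esum_(l in L) (sqnorm (phi (s - l)))%:E = 1)%E.

(** All the zeros of the masks involved are rational, so for [s] outside [E]
    no mask vanishes at [s - l], at any scale. *)
Definition generic (E L : set R) :=
  forall s l, ~ E s -> L l -> forall q : rat, s - l != ratr q.

Variables (phi psi : R -> R[i]) (E L : set R).
Hypothesis phiE : forall xi, phi xi = mask B (xi / p%:R) * psi xi.
Hypothesis psi_bessel : bessel_bound psi.
Hypothesis psi_neq0 : forall A, countable A -> exists2 t, ~ A t & psi t != 0.
Hypotheses (cE : countable E) (gEL : generic E L).
Hypothesis parsL : parseval phi E L.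

Let d : R := p%:R / M%:R.
Let p0 : (p%:R : R) != 0. Proof. by rewrite pnatr_eq0 -lt0n. Qed.
Let M0 : (M%:R : R) != 0. Proof. by rewrite pnatr_eq0 -lt0n. Qed.
Let d_gt0 : 0 < d. Proof. by rewrite divr_gt0 ?ltr0n. Qed.
Let dM : d * M%:R = p%:R. Proof. by rewrite /d divfK. Qed.

Lemma maskD (t : R) (k : int) : mask B (t + k%:~R) = mask B t.
Proof.
rewrite /mask; congr (_ * _); apply: eq_bigr => b _.
by rewrite charDl (@char_int _ k%:~R b%:~R (k * b)) ?mulr1// intrM.
Qed.

Lemma mask0 : mask B (0 : R) = 1.
Proof.
rewrite /mask; under eq_bigr do rewrite char0.
case: hB => cB _; rewrite /= big_const_seq count_predT iter_addr_0.
by rewrite -[size _]/(#|` B|%fset) cB mulVf// pnatr_eq0 -lt0n.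
Qed.

Lemma mask_int (k : int) : mask B (k%:~R : R) = 1.
Proof. by rewrite -[k%:~R]add0r maskD mask0. Qed.

Let base := cell_base d.
Let idx := cell_idx d M_gt0.

(** The mask at [(s - x) / p] depends on [x] only through its cell. *)
Let w (s a : R) (i : 'I_M) : R := sqnorm (mask B ((s - a - d * i%:R) / p%:R)).

Let wE s x : w s (base x) (idx x) = sqnorm (mask B ((s - x) / p%:R)).
Proof.
have [z hz] := cell_decomp d M_gt0 x.
rewrite -(maskD _ z) /w; congr (sqnorm (mask B _)).
rewrite [X in _ = (s - X) / _ + _]hz -/base -/idx dM; field; exact: p0.
Qed.

Let w_gt0 s x i : ~ E s -> L x -> 0 < w s (base x) i.
Proof.
move=> nEs Lx; rewrite lt_neqAle sqnorm_ge0 andbT eq_sym sqnorm_eq0; apply/eqP => h.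
have [k hk] := mask_zero M_gt0 hB uz h.
(* A zero of the mask would make [s - x] rational; the integer [j] also
   accounts for the distance from [x] to its cell base. *)
pose j := k + i%:Z - Num.floor (x / d).
suff : s - x = ratr (j%:~R * p%:R / M%:R).
  by apply/eqP; exact: gEL.
rewrite !rmorphM fmorphV /= !rmorph_nat ratr_int.
rewrite /j rmorphB rmorphD /= -hk /base /cell_base /d -[(Posz i)%:~R]/(i%:R).
by field; rewrite M0 p0.
Qed.

Let sum_w s x : \sum_i w s (base x) i = 1.
Proof.
rewrite -[RHS](sum_mask_translates M_gt0 hB ((s - base x) / p%:R)).
apply: eq_bigr => i _; congr (sqnorm (mask B _)); rewrite /d; field.
by rewrite M0 p0.
Qed.

(** A zero of the mask at [(x - y) / p] puts [x] and [y] in one class, hence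
    in the same selected cell; but then [(x - y) / p] is an integer, where the
    mask is 1. *)
Let selection_orthogonal tau : orthogonal psi (selection L base idx tau).
Proof.
move=> x y [Lx ix] [Ly iy] xy; have [oL _] := parsL.
have := oL x y Lx Ly xy; rewrite phiE => /eqP.
rewrite mulf_eq0 => /orP[/eqP h|/eqP//].
have [k hk] := mask_zero M_gt0 hB uz h.
have xyd : x - y = d * k%:~R.
  rewrite -hk /d; by field; rewrite M0 p0.
have bxy : base x = base y by apply/(cell_baseP d_gt0); exists k.
have ixy : idx x = idx y by rewrite ix iy bxy.
have /dvdzP[l kl] := (cell_idxP d_gt0 M_gt0 xyd).1 ixy.
move: h; rewrite (_ : (x - y) / p%:R = l%:~R) ?mask_int; last first.
  by rewrite xyd kl rmorphM /= /d; by field; rewrite M0 p0.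
by move/eqP; rewrite oner_eq0.
Qed.

Let sum_wp s : ~ E s ->
  (\esum_(x in L) (w s (base x) (idx x) * sqnorm (psi (s - x)))%:E = 1)%E.
Proof.
move=> nEs; have [_ /(_ _ nEs) <-] := parsL.
by apply: eq_esum => x _; rewrite wE phiE sqnormM.
Qed.

Lemma selection_parseval (tau : R -> 'I_M) :
  parseval psi E (selection L base idx tau).
Proof.
split; first exact: selection_orthogonal.
move=> s nEs; apply: (sum_selection (w := w s)).
- by move=> x Lx i; exact: w_gt0.
- by move=> x _; exact: sum_w.
- by move=> x; exact: sqnorm_ge0.
- exact: sum_wp.
- by move=> tau'; apply: psi_bessel; exact: selection_orthogonal.
Qed.

(** For a translation [s] at which [x] contributes to the mass of its own
    cell, the other cells of the class have the same positive mass. *)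
Lemma cells_full (x : R) (i : 'I_M) : L x ->
  exists y, [/\ L y, base y = base x & idx y = i].
Proof.
move=> Lx.
have cA : countable [set t | E (t + x)].
  rewrite (_ : [set t | E (t + x)] = (fun s => s - x) @` E).
    exact: sub_countable (card_image_le _ _) cE.
  by apply/seteqP; split=> [t Et|t [s Es <-]] /=;
    [exists (t + x); rewrite ?addrK|rewrite subrK].
have [t nEt psit] := psi_neq0 cA; set s := t + x.
have nEs : ~ E s by [].
apply: contrapT => ne.
have le1 tau :
    (\esum_(y in selection L base idx tau) (sqnorm (psi (s - y)))%:E <= 1)%E.
  by apply: psi_bessel; exact: selection_orthogonal.
have := cell_mass_const (g := base) (idx := idx) (w := w s)
  (p := fun x => sqnorm (psi (s - x))) (L := L) _ _ _ (sum_wp nEs) _ i (idx x) Lx.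
move=> /(_ (fun x Lx i => w_gt0 i nEs Lx) (fun x _ => sum_w s x)
  (fun x => sqnorm_ge0 _) le1).
rewrite {1}/cell_mass (_ : _ `&` [set y | idx y = i] = set0) ?esum_set0; last first.
  by apply/seteqP; split => // y [[Ly by_] iy]; apply: ne; exists y.
move=> h.
have : (0 < cell_mass L base idx (fun x => sqnorm (psi (s - x))) (base x) (idx x))%E.
  rewrite /cell_mass; apply: (@lt_le_trans _ _ (sqnorm (psi (s - x)))%:E).
    by rewrite lte_fin lt_neqAle sqnorm_ge0 andbT eq_sym sqnorm_eq0 /s addrK.
  apply: esum_ge; exists [set x]; last by rewrite fsbig_set1.
  by split; [exact: finite_set1|move=> _ ->].
by rewrite -h ltxx.
Qed.

End step.

(** * Two consecutive scales and the theorem *)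

Lemma cells_full_shift (R : realType) (p M : nat) (B : {fset int})
    (phi psi : R -> R[i]) (E L : set R) (x : R) :
  (0 < p)%N -> (0 < M)%N -> complete_residue_system M B ->
  uniform_discrete_zero R M B ->
  (forall xi, phi xi = mask B (xi / p%:R) * psi xi) -> bessel_bound psi ->
  (forall A, countable A -> exists2 t, ~ A t & psi t != 0) ->
  countable E -> generic E L -> parseval phi E L -> L x ->
  exists2 y, L y & exists z : int, y - x = p%:R / M%:R * (1 + M%:Z * z)%:~R.
Proof.
move=> p0 M0 hB uz phiE bpsi npsi cE gEL pL Lx.
pose d : R := p%:R / M%:R.
have d0 : 0 < d by rewrite divr_gt0 ?ltr0n.
have [y [Ly yx iy]] := cells_full p0 M0 hB uz phiE bpsi npsi cE gEL pL
  (cell_idx d M0 (x + d)) Lx.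
exists y => //.
have : cell_base d y = cell_base d (x + d).
  by rewrite yx; apply/(cell_baseP d0); exists (-1); rewrite mulrN1; ring.
move=> /(cell_baseP d0)[k yk].
have /dvdzP[z kz] := (cell_idxP d0 M0 yk).1 iy.
exists z; rewrite -[y](subrK (x + d)) yk kz -/d !rmorphD !rmorphM /=; ring.
Qed.

(** If [M'] did not divide [n], a shift by [d' = p * n / M'] would leave the
    class of [l0] modulo [d = p / M]; moving the selected cell in the class of
    [l0] only would then drag along the selected cell of another class. *)
Lemma two_scales_dvdn (R : realType) (p n M M' : nat) (B B' : {fset int})
    (phi psi chi : R -> R[i]) (E L : set R) :
  (0 < p)%N -> (0 < n)%N -> (1 < M)%N -> (0 < M')%N ->
  complete_residue_system M B -> uniform_discrete_zero R M B ->
  complete_residue_system M' B' -> uniform_discrete_zero R M' B' ->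
  (forall xi, phi xi = mask B (xi / p%:R) * psi xi) ->
  (forall xi, psi xi = mask B' (xi / (p * n)%:R) * chi xi) ->
  bessel_bound psi -> (forall A, countable A -> exists2 t, ~ A t & psi t != 0) ->
  bessel_bound chi -> (forall A, countable A -> exists2 t, ~ A t & chi t != 0) ->
  countable E -> generic E L -> parseval phi E L -> L !=set0 -> (M' %| n)%N.
Proof.
move=> p0 n0 M1 M'0 hB uz hB' uz' phiE psiE bpsi npsi bchi nchi cE gEL pL [l0 Ll0].
have M0 : (0 < M)%N by exact: ltnW.
have pn0 : (0 < p * n)%N by rewrite muln_gt0 p0.
pose d : R := p%:R / M%:R.
have d0 : 0 < d by rewrite divr_gt0 ?ltr0n.
have pR : (p%:R : R) != 0 by rewrite pnatr_eq0 -lt0n.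
have MR : (M%:R : R) != 0 by rewrite pnatr_eq0 -lt0n.
have M'R : (M'%:R : R) != 0 by rewrite pnatr_eq0 -lt0n.
pose base := cell_base d; pose idx := cell_idx d M0.
pose sel tau := selection L base idx tau.
have shift tau x : sel tau x ->
    exists2 y, sel tau y &
    exists z : int, y - x = (p * n)%:R / M'%:R * (1 + M'%:Z * z)%:~R.
  apply: (cells_full_shift pn0 M'0 hB' uz' psiE bchi nchi cE).
    by move=> s l nEs [Ll _]; exact: gEL.
  exact: (selection_parseval p0 M0 hB uz phiE bpsi gEL pL).
apply: contrapT => nM'n.
pose tau0 : R -> 'I_M := fun=> idx l0.
have [|l1 [Ll1 il1] [z1 l1E]] := shift tau0 l0; first by split.
have bl1 : base l1 != base l0.
  apply/eqP => /(cell_baseP d0)[k lk].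
  (* Both points are selected in one class, so they share a cell and
     [l1 - l0] is a multiple of [p]. *)
  have /dvdzP[k' kk'] := (cell_idxP d0 M0 lk).1 il1.
  apply: nM'n.
  have e : n%:Z * (1 + M'%:Z * z1) = M'%:Z * k'.
    apply/eqP; rewrite -(eqr_int R) !rmorphM rmorphD rmorphM /=; apply/eqP.
    move: l1E; rewrite lk kk' /d natrM rmorphD !rmorphM /= => h.
    apply: (mulfI pR); apply: (mulfI (invr_neq0 M'R)).
    transitivity (p%:R / M%:R * (k'%:~R * M%:R) : R); last by field; rewrite MR M'R.
    by rewrite h; field.
  rewrite -[(M' %| n)%N]/(M'%:Z %| n%:Z)%Z.
  rewrite (_ : n%:Z = M'%:Z * (k' - n%:Z * z1)); first exact: dvdz_mulr.
  by rewrite mulrBr -e; ring.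
have [l2 Ll2 [z2 l2E]] :=
  cells_full_shift p0 M0 hB uz phiE bpsi npsi cE gEL pL Ll0.
pose tau1 : R -> 'I_M := fun a => if a == base l0 then idx l2 else tau0 a.
have bl2 : base l2 = base l0 by apply/(cell_baseP d0); eexists; exact: l2E.
have [|l3 [Ll3 il3] [z3 l3E]] := shift tau1 l2.
  by split => //=; rewrite /tau1 bl2 eqxx.
(* Modulo [p], the two shifts by [p * n / M'] cancel and only the shift by
   [d] from [l0] to [l2] is left. *)
have l31 : l3 - l1 = d * (1 + M%:Z * (z2 + n%:Z * (z3 - z1)))%:~R.
  transitivity ((l3 - l2) + (l2 - l0) - (l1 - l0)); first by ring.
  rewrite l3E l2E l1E /d natrM !(rmorphD, rmorphM, rmorphN, rmorphB) /=; field.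
  by rewrite MR M'R.
have bl3 : base l3 = base l1 by apply/(cell_baseP d0); eexists; exact: l31.
have : idx l3 = idx l1.
  by rewrite il3 il1 /tau1 bl3 (negbTE bl1).
move/(cell_idxP d0 M0 l31); rewrite rpredDr ?dvdz_mulr//.
by rewrite dvdz1 /= => /eqP M1'; rewrite M1' in M1.
Qed.

Lemma bessel_bound_char_fun (R : realType) (m : probability R R) (c : R) : c != 0 ->
  bessel_bound (fun xi => char_fun m (xi / c)).
Proof.
move=> c0 L s oL.
have inj : set_inj L (fun l : R => l / c).
  by move=> x y _ _ /(mulIf (invr_neq0 c0)).
rewrite (eq_esum (b := fun l => (sqnorm (char_fun m (s / c - l / c)))%:E)); last first.
  by move=> l _; rewrite mulrBl.
rewrite -(esum_image L (fun l => l / c)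
  (fun l => (sqnorm (char_fun m (s / c - l)))%:E))//.
apply: orthogonal_esum_le1 => _ _ [i Li <-] [j Lj <-] ij.
by rewrite -mulrBl; apply: oL => //; apply: contraNneq ij => ->.
Qed.

Lemma char_fun_scaled_neq0_off_countable (R : realType) (m : probability R R) (c : R) :
  c != 0 -> forall A, countable A -> exists2 t, ~ A t & char_fun m (t / c) != 0.
Proof.
move=> c0 A cA.
have [|t nAt ht] := @char_fun_neq0_off_countable R m ((fun t => t / c) @` A).
  exact: sub_countable (card_image_le _ _) cA.
exists (t * c); last by rewrite mulfK.
by move=> Atc; apply: nAt; exists (t * c); rewrite ?mulfK.
Qed.

Lemma countable_rational_translates (R : realType) (L : set R) : countable L ->
  countable [set s | exists l q, L l /\ s - l = ratr q].
Proof.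
move=> cL.
have : countable (\bigcup_(l in L) range (fun q : rat => l + ratr q)).
  apply: bigcup_countable => // l _.
  exact: sub_countable (card_image_le _ _) (countableP _).
apply: sub_countable; apply: subset_card_le => s [l [q [Ll sl]]].
by exists l => //; exists q => //; rewrite -sl addrC subrK.
Qed.

Theorem theorem2p4 (R : realType) (N M : nat -> nat) (B : nat -> {fset int})
    (mu : probability R R) (nu : nat -> probability R R)
    (hB : forall k : nat, (1 <= k)%N -> complete_residue_system (M k) (B k))
    (hNM : forall k : nat, (1 <= k)%N -> (2 <= M k)%N /\ (M k <= N k)%N)
    (hmu : is_infinite_convolution N B mu)
    (hnu : forall k : nat, (1 <= k)%N -> is_tail_convolution N B k (nu k))
    (hzero : forall k : nat, (1 <= k)%N ->
       uniform_discrete_zero R (M k) (B k))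
    (htight : tight [set nu k | k in [set k : nat | (1 <= k)%N]])
    (hspec : is_spectral_measure mu) :
  forall k : nat, (2 <= k)%N -> (M k %| N k)%N.
Proof.
have [L [cL /spectral_parseval[oL sL]]] := hspec.
have N0 i : (1 <= i)%N -> (0 < N i)%N.
  by move=> /hNM [M2 MN]; exact: leq_trans (ltnW M2) MN.
have M0 i : (1 <= i)%N -> (0 < M i)%N by move=> /hNM [M2 _]; exact: ltnW.
pose tail k := if k is 0 then mu else nu k.
have htail k : is_tail_convolution N B k (tail k).
  by case: k => [|k]; [exact: hmu|exact: hnu].
pose P k := (\prod_(1 <= i < k.+1) N i)%N.
have PS k : P k.+1 = (P k * N k.+1)%N by rewrite /P big_nat_recr.
have P_gt0 k : (0 < P k)%N.
  by elim: k => [|k ih]; [rewrite /P big_geq|rewrite PS muln_gt0 ih N0].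
have PR k : (P k)%:R != 0 :> R by rewrite pnatr_eq0 -lt0n.
pose phi k (xi : R) := char_fun (tail k) (xi / (P k)%:R).
have phiS k xi : phi k xi = mask (B k.+1) (xi / (P k.+1)%:R) * phi k.+1 xi.
  rewrite /phi (char_fun_tail N0 _ (htail k) (htail k.+1)) PS natrM.
  by rewrite invfM mulrA.
have phi_bessel k : bessel_bound (phi k) by exact: bessel_bound_char_fun.
have phi_neq0 k := char_fun_scaled_neq0_off_countable (tail k) (PR k).
pose E := [set s | exists l q, L l /\ s - l = ratr q].
have cE : countable E by exact: countable_rational_translates.
have gE L' : L' `<=` L -> generic E L'.
  move=> L'L s l nEs L'l q; apply/eqP => slq; apply: nEs.
  by exists l, q; split => //; exact: L'L.
(* Descend from [mu] to scale [k], always keeping the cells of index 0. *)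
have pars k : exists2 L', L' `<=` L & parseval (phi k) E L'.
  elim: k => [|k [L' L'L pL']].
    exists L => //; rewrite /phi /P big_geq// /tail.
    split=> [i j Li Lj ij|s _]; first by rewrite divr1; exact: oL.
    by rewrite -[RHS](sL s); apply: eq_esum => l _; rewrite divr1.
  have M0k : (0 < M k.+1)%N by exact: M0.
  exists (selection L' (cell_base ((P k.+1)%:R / (M k.+1)%:R))
    (cell_idx ((P k.+1)%:R / (M k.+1)%:R) M0k) (fun=> Ordinal M0k)).
    by move=> x [/L'L].
  apply: (selection_parseval (P_gt0 k.+1) M0k (hB k.+1 isT) (hzero k.+1 isT)
    (phiS k) (phi_bessel k.+1) (gE _ L'L) pL').
move=> [|[|k]]// _.
have [L' L'L pL'] := pars k.
apply: (two_scales_dvdn (P_gt0 k.+1) (N0 k.+2 isT) (hNM k.+1 isT).1 (M0 k.+2 isT)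
  (hB k.+1 isT) (hzero k.+1 isT) (hB k.+2 isT) (hzero k.+2 isT) (phiS k) _
  (phi_bessel k.+1) (phi_neq0 k.+1) (phi_bessel k.+2) (phi_neq0 k.+2) cE
  (gE _ L'L) pL').
  by move=> xi; rewrite -PS.
have [s nEs _] := phi_neq0 0%N _ cE.
apply/set0P/eqP => L'0; have [_ /(_ s nEs)] := pL'.
by rewrite L'0 esum_set0 => -[] /eqP; rewrite eq_sym oner_eq0.
Qed.
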